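(* Let $\Gamma$ be a finite connected graph without loops. Then the set of closed occupation measures on $T\Gamma$ is dense in the set $\mathbb M$ of all closed probability measures on $T\Gamma$ with finite first moment, with respect to the (first) Wasserstein topology.
   Context: Graph. $\Gamma=(V,E)$ consists of disjoint finite sets $V$ (vertices) and $E\neq\emptyset$ (directed edges), a map $o:E\to V$ (origin) and a fixed-point-free involution $e\mapsto -e$ of $E$; $t(e):=o(-e)$ is the terminal vertex. A path is a finite sequence $(e_i)_{i=1}^M$ of edges with $t(e_i)=o(e_{i+1})$ for $1\le i<M$; its origin is $o(e_1)$ and its terminal vertex is $t(e_M)$. $\Gamma$ is connected (any two vertices are linked by a path) and has no loops ($o(e)\ne t(e)$ for all $e$). Tangent bundle. $T\Gamma=(E\times[0,+\infty))/\sim$, where $(e,0)\sim(-e,0)$; $\mathbb R^+_e:=\{e\}\times[0,+\infty)$. The metric is $d((e_1,q_1),(e_2,q_2))=q_1+q_2+1$ if $e_1\ne\pm e_2$, $|q_1-q_2|$ if $e_1=e_2$, $q_1+q_2$ if $e_1=-e_2$. Measures. $\mathbb P$ is the set of Borel probability measures $\mu$ on $T\Gamma$ with $\int q\,d\mu<+\infty$, endowed with the first Wasserstein distance; equivalently, $\mu_n\to\mu$ iff $\int F\,d\mu_n\to\int F\,d\mu$ for all continuous $F:T\Gamma\to\mathbb R$ with linear growth ($|F(e,q)|\le a_eq+b_e$ for suitable constants $a_e,b_e$). For $f:V\to\mathbb R$ set $df(e)=f(t(e))-f(o(e))$ and $\int df\,d\mu:=\sum_{e\in E}df(e)\int_{\mathbb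 R^+_e}q\,d\mu$. The measure $\mu\in\mathbb P$ is closed if $\int df\,d\mu=0$ for every $f:V\to\mathbb R$; $\mathbb M\subset\mathbb P$ is the set of closed measures. Parametrized paths. A parametrized path is $\xi=(e_i,q_i,T_i)_{i=1}^M$ such that: (i) $(e_i)_{i=1}^M$ is a path (the support of $\xi$); (ii) $q_i\ge0$, $T_i=1/q_i$ if $q_i>0$, and $T_i$ is an arbitrary positive constant if $q_i=0$; (iii) if all $q_i$ vanish then $o(e_1)=t(e_M)$; (iv) if $q_i=0$ and $e_{i+1}\ne-e_i$ then $q_{i+1}\neq0$; (v) if $q_i\ne0$ and $i>1$, then $o(e_i)=t(e_j)$ with $j=\max\{k<i: q_k\ne0\}$ (and $o(e_i)=o(e_1)$ if there is no such $k$). Its occupation measure is $\mu_\xi=\frac1{T_\xi}\sum_{i=1}^M T_i\,\delta(e_i,q_i)$, where $T_\xi=\sum_iT_i$ and $\delta(e,q)$ is the Dirac measure at $(e,q)$. A closed occupation measure is an occupation measure which is a closed measure. *)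

(* Defs.v *)
From HB Require Import structures.
From mathcomp Require Import all_boot all_order all_algebra generic_quotient.
From mathcomp Require Import all_classical all_reals all_analysis.
From mathcomp Require Import lra.

Set Implicit Arguments.
Unset Strict Implicit.
Unset Printing Implicit Defensive.

Import Order.TTheory GRing.Theory Num.Theory.
Import numFieldNormedType.Exports.

Local Open Scope classical_set_scope.
Local Open Scope ring_scope.

Record graph := Graph {
  vertex : finType;
  edge : finType;
  origin : edge -> vertex;
  eopp : edge -> edge;
  eoppK : involutive eopp;
  eopp_neq : forall e, eopp e != e;
  edge_neq0 : (0 < #|edge|)%N }.

Definition terminal (G : graph) (e : edge G) : vertex G := origin (eopp e).

(* A path (e_1, ..., e_M), M >= 1, is indexed from 0 as a map on 'I_n.+1 with
   M = n.+1. *)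
Definition is_path (G : graph) (n : nat) (p : 'I_n.+1 -> edge G) : Prop :=
  forall i j : 'I_n.+1, j = i.+1 :> nat -> terminal (p i) = origin (p j).

Definition connected_graph (G : graph) : Prop :=
  forall x y : vertex G, exists n (p : 'I_n.+1 -> edge G),
    [/\ is_path p, origin (p ord0) = x & terminal (p ord_max) = y].

Definition loopless (G : graph) : Prop :=
  forall e : edge G, origin e <> terminal e.

Section TangentBundle.
Variables (G : graph) (R : realType).

Definition pretangent : Type := (edge G * {nonneg R})%type.

HB.instance Definition _ := Choice.on pretangent.

Definition tangent_rel (x y : pretangent) : bool :=
  (x == y) || [&& y.1 == eopp x.1, x.2%:num == 0 & y.2%:num == 0].

Lemma tangent_rel_refl : reflexive tangent_rel.
Proof. by move=> x; rewrite /tangent_rel eqxx. Qed.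

Lemma tangent_rel_sym : symmetric tangent_rel.
Proof.
suff H x y : tangent_rel x y -> tangent_rel y x.
  by move=> x y; apply/idP/idP; exact: H.
case/orP => [/eqP ->|/and3P[/eqP yx x0 y0]]; first exact: tangent_rel_refl.
by apply/orP; right; rewrite yx eoppK eqxx x0 y0.
Qed.

Lemma tangent_rel_trans : transitive tangent_rel.
Proof.
move=> y x z /orP[/eqP -> //|/and3P[/eqP yx x0 y0]].
case/orP => [/eqP <-|/and3P[/eqP zy _ z0]].
  by apply/orP; right; rewrite yx eqxx x0 y0.
apply/orP; left; apply/eqP; case: x z yx zy x0 z0 => [e q] [f r] /= yx -> + +.
rewrite yx eoppK => /eqP q0 /eqP r0.
by congr pair; apply/val_inj; rewrite /= q0 r0.
Qed.

Canonical tangent_equiv :=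
  EquivRel tangent_rel tangent_rel_refl tangent_rel_sym tangent_rel_trans.

Definition tangent : Type := {eq_quot tangent_equiv}%qT.

HB.instance Definition _ := Choice.on tangent.
HB.instance Definition _ := EqQuotient.on tangent.

Definition tpoint (e : edge G) (q : {nonneg R}) : tangent :=
  (\pi_tangent (e, q))%qT.

Definition tspeed (x : tangent) : R := (repr x).2%:num.

Definition predist (x y : pretangent) : R :=
  if x.1 == y.1 then `|x.2%:num - y.2%:num|
  else if x.1 == eopp y.1 then x.2%:num + y.2%:num
  else x.2%:num + y.2%:num + 1.

Definition tdist (x y : tangent) : R := predist (repr x) (repr y).

(* The formulas for the metric and for q do not depend on representatives. *)
Lemma tpoint_rel e q : tangent_rel (repr (tpoint e q)) (e, q).
Proof. by apply/(@eqmodP _ tangent_equiv); rewrite reprK. Qed.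

Lemma tpoint_eopp e : tpoint (eopp e) 0%:nng = tpoint e 0%:nng.
Proof.
apply/(@eqmodP _ tangent_equiv); apply/orP; right => /=.
by rewrite eoppK !eqxx.
Qed.

Lemma tspeedE e q : tspeed (tpoint e q) = q%:num.
Proof.
rewrite /tspeed; case/orP: (tpoint_rel e q) => [/eqP -> //|].
by case/and3P => _ /eqP -> /eqP /= ->.
Qed.

Lemma predist_sym x y : predist x y = predist y x.
Proof.
rewrite /predist eq_sym [y.2%:num + x.2%:num]addrC distrC.
by rewrite [y.1 == eopp _]eq_sym (can2_eq (@eoppK G) (@eoppK G)).
Qed.

Lemma predist_rel x x' y : tangent_rel x x' -> predist x y = predist x' y.
Proof.
case/orP => [/eqP -> //|/and3P[/eqP x'x /eqP x0 /eqP x'0]].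
rewrite /predist x0 x'0 x'x !sub0r !add0r normrN ger0_norm//.
rewrite (inj_eq (inv_inj (@eoppK G))) [eopp x.1 == _](can2_eq (@eoppK G) (@eoppK G)).
by case: ifPn => // _; case: ifPn.
Qed.

Lemma tdistE e q f r :
  tdist (tpoint e q) (tpoint f r) =
  if e == f then `|q%:num - r%:num|
  else if e == eopp f then q%:num + r%:num
  else q%:num + r%:num + 1.
Proof.
rewrite /tdist (predist_rel _ (tpoint_rel e q)) predist_sym.
by rewrite (predist_rel _ (tpoint_rel f r)) predist_sym.
Qed.

Lemma tdistxx x : tdist x x = 0.
Proof. by rewrite /tdist /predist eqxx subrr normr0. Qed.

Lemma tdist_positivity x y : tdist x y = 0 -> x = y.
Proof.
rewrite /tdist => xy; rewrite -[x]reprK -[y]reprK; move: xy.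
case: (repr x) (repr y) => [e q] [f r]; rewrite /predist/= => qr.
have q0 : 0 <= q%:num by [].
have r0 : 0 <= r%:num by [].
apply/(@eqmodP _ tangent_equiv); rewrite /= /tangent_rel /=; move: qr.
case: eqVneq => [<- /eqP|ef].
  by rewrite normr_eq0 subr_eq0 => /eqP qr; rewrite (val_inj qr) eqxx.
case: eqVneq => [-> qr|_ qr]; last by exfalso; lra.
apply/orP; right; rewrite eoppK eqxx /=.
by apply/andP; split; apply/eqP; lra.
Qed.

Lemma tdist_sym x y : tdist x y = tdist y x.
Proof. exact: predist_sym. Qed.

Lemma tdist_triangle y x z : tdist x z <= tdist x y + tdist y z.
Proof.
rewrite /tdist /predist; move: (repr x) (repr y) (repr z) => [e q] [f r] [g s] /=.
have q0 : 0 <= q%:num by [].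
have r0 : 0 <= r%:num by [].
have s0 : 0 <= s%:num by [].
have N (a b : R) : 0 <= a -> 0 <= b ->
    [/\ a - b <= `|a - b|, b - a <= `|a - b| & `|a - b| <= a + b].
  move=> a0 b0; rewrite ler_norm -[b - a]opprB ler_normr lexx orbT; split => //.
  by rewrite (le_trans (ler_normB _ _))// !ger0_norm.
have [? ? ?] := N _ _ q0 r0; have [? ? ?] := N _ _ r0 s0.
have [? ? ?] := N _ _ q0 s0.
case: (eqVneq e g) => [eg|eg]; case: (eqVneq e f) => [ef|ef];
  case: (eqVneq f g) => [fg|fg]; try lra.
- by rewrite -[X in `|X|](subrKA r%:num) ler_normD.
- by exfalso; move: fg; rewrite -ef eg eqxx.
- by exfalso; move: ef; rewrite fg eg eqxx.
- by case: ifP => _; case: ifP => _; lra.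
- by exfalso; move: eg; rewrite ef fg eqxx.
- by rewrite ef; case: ifP => _; lra.
- by rewrite fg; case: ifP => _; lra.
- case: (eqVneq e (eopp f)) => [ef'|ef']; case: (eqVneq f (eopp g)) => [fg'|fg'].
  + by exfalso; move: eg; rewrite ef' fg' eoppK eqxx.
  + by case: ifP => _; lra.
  + by case: ifP => _; lra.
  + by case: ifP => _; lra.
Qed.

HB.instance Definition _ := @isMetric.Build R tangent tdist
  tdistxx tdist_positivity tdist_sym tdist_triangle.

HB.instance Definition _ := isPointed.Build tangent
  (tpoint (enum_val (Ordinal (edge_neq0 G))) 0%:nng).

(* Borel sigma-algebra of the metric topology. *)
HB.instance Definition _ :=
  Measurable.copy tangent (g_sigma_algebraType (@open tangent)).

Definition ray (e : edge G) : set tangent := range (tpoint e).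

Definition finite_first_moment (mu : probability tangent R) : Prop :=
  (\int[mu]_x (tspeed x)%:E < +oo)%E.

Definition coupling (mu nu : probability tangent R) :
    set (probability (tangent * tangent)%type R) :=
  [set pi | forall A : set tangent, measurable A ->
     pi (A `*` setT) = mu A /\ pi (setT `*` A) = nu A].

Definition wasserstein1 (mu nu : probability tangent R) : \bar R :=
  ereal_inf [set \int[pi]_z (mdist z.1 z.2)%:E | pi in coupling mu nu]%E.

Definition differential (f : vertex G -> R) (e : edge G) : R :=
  f (terminal e) - f (origin e).

Definition closed_measures : set (probability tangent R) :=
  [set mu | finite_first_moment mu /\
     forall f : vertex G -> R,
       \sum_(e : edge G) differential f e * (\int[mu]_(x in ray e) tspeed x)%R
         = 0].

(* Density for the metric wasserstein1; it is finite on measures with finite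
   first moment. *)
Definition wasserstein_dense (A B : set (probability tangent R)) : Prop :=
  A `<=` B /\
  forall mu, B mu -> forall eps : R, 0 < eps ->
    exists2 nu, A nu & (wasserstein1 mu nu < eps%:E)%E.

(* In pp_prev, j is the largest index below i with nonzero speed; pp_noprev is
   the case where there is no such index. *)
Record param_path := ParamPath {
  pp_pred_len : nat;
  pp_edge : 'I_pp_pred_len.+1 -> edge G;
  pp_speed : 'I_pp_pred_len.+1 -> {nonneg R};
  pp_time : 'I_pp_pred_len.+1 -> {posnum R};
  pp_path : is_path pp_edge;
  pp_timeE : forall i, 0 < (pp_speed i)%:num ->
    (pp_time i)%:num = 1 / (pp_speed i)%:num;
  pp_all0 : (forall i, (pp_speed i)%:num = 0) ->
    origin (pp_edge ord0) = terminal (pp_edge ord_max);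
  pp_turn : forall i j : 'I_pp_pred_len.+1, j = i.+1 :> nat ->
    (pp_speed i)%:num = 0 -> pp_edge j <> eopp (pp_edge i) ->
    (pp_speed j)%:num <> 0;
  pp_prev : forall i j : 'I_pp_pred_len.+1, (pp_speed i)%:num <> 0 ->
    (j < i)%N -> (pp_speed j)%:num <> 0 ->
    (forall k : 'I_pp_pred_len.+1, (j < k < i)%N -> (pp_speed k)%:num = 0) ->
    origin (pp_edge i) = terminal (pp_edge j);
  pp_noprev : forall i : 'I_pp_pred_len.+1, (pp_speed i)%:num <> 0 ->
    (forall k : 'I_pp_pred_len.+1, (k < i)%N -> (pp_speed k)%:num = 0) ->
    origin (pp_edge i) = origin (pp_edge ord0) }.

Arguments pp_edge : clear implicits.
Arguments pp_speed : clear implicits.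
Arguments pp_time : clear implicits.

Definition total_time (xi : param_path) : R := \sum_i (pp_time xi i)%:num.

Definition occupation_measure (xi : param_path) (A : set tangent) : \bar R :=
  ((total_time xi)^-1%:E * \sum_(i < (pp_pred_len xi).+1)
     (pp_time xi i)%:num%:E *
     dirac (tpoint (pp_edge xi i) (pp_speed xi i)) A)%E.

Lemma total_time_gt0 xi : 0 < total_time xi.
Proof. by rewrite /total_time big_ord_recl ltr_wpDr// sumr_ge0. Qed.

Section OccupationProbability.
Variable xi : param_path.

Let occupation_measureE : occupation_measure xi =
  mscale (PosNum (total_time_gt0 xi))%:num^-1%:nng
    (msum (fun k => mscale (pp_time xi (inord k))%:num%:nng
      (dirac (tpoint (pp_edge xi (inord k)) (pp_speed xi (inord k)))))
      (pp_pred_len xi).+1).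
Proof.
apply/funext => A; rewrite /mscale /msum /= /occupation_measure; congr (_ * _)%E.
by apply: eq_bigr => i _; rewrite inord_val.
Qed.

Let occupation_measure0 : occupation_measure xi set0 = 0%E.
Proof. by rewrite occupation_measureE measure0. Qed.

Let occupation_measure_ge0 A : (0 <= occupation_measure xi A)%E.
Proof. by rewrite occupation_measureE measure_ge0. Qed.

Let occupation_measure_sigma_additive :
  semi_sigma_additive (occupation_measure xi).
Proof. by rewrite occupation_measureE; exact: measure_semi_sigma_additive. Qed.

HB.instance Definition _ := isMeasure.Build _ tangent R (occupation_measure xi)
  occupation_measure0 occupation_measure_ge0 occupation_measure_sigma_additive.

Let occupation_measure_setT : occupation_measure xi setT = 1%E.
Proof.
rewrite /occupation_measure; under eq_bigr do rewrite diracT mule1.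
by rewrite sumEFin -EFinM mulVf// gt_eqF// total_time_gt0.
Qed.

HB.instance Definition _ := Measure_isProbability.Build _ tangent R
  (occupation_measure xi) occupation_measure_setT.

End OccupationProbability.

Definition closed_occupation_measures : set (probability tangent R) :=
  range (fun xi => occupation_measure xi : probability tangent R)
    `&` closed_measures.

End TangentBundle.

Arguments pp_edge {G R} _ _.
Arguments pp_speed {G R} _ _.
Arguments pp_time {G R} _ _.

(* Main.v *)
(* A closed measure assigns to each edge e the flux F e, the integral of q over
   the ray of e, and F is a circulation. Quantize the speeds by a simple function
   with finitely many positive values, so that mu is close to a sum of masses m_i
   at points (e_i, s_i). A traversal of e_i at speed s_i lasts 1 / s_i, so a path
   of duration about N must contain about N m_i s_i of them. Rounding these
   numbers to integers, and adding unit-speed arcs to make up for the small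
   difference between F e and the quantized flux, gives arc counts whose imbalance
   at each vertex is bounded independently of N. Boundedly many further unit-speed
   arcs restore the balance and connect the support, so an Eulerian argument
   yields a closed walk with these counts. No zero speed is needed: mass at a
   vertex is carried at small positive speed. Most of the mass of each class is
   transported to the point of its class; the small remainder goes to the
   unit-speed arcs. *)
From HB Require Import structures.
Require Import Defs.
From mathcomp Require Import all_boot all_order all_algebra.
From mathcomp Require Import generic_quotient finmap.
From mathcomp Require Import all_classical all_reals all_analysis.
From mathcomp Require Import measurable_realfun zify ring lra.

Set Implicit Arguments.
Unset Strict Implicit.
Unset Printing Implicit Defensive.

Import Order.TTheory GRing.Theory Num.Theory.
Import numFieldNormedType.Exports.

Local Open Scope classical_set_scope.
Local Open Scope ring_scope.

(** * Closed walks with prescribed arc multiplicities *)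

Lemma all_flatten (T : Type) (a : pred T) (ss : seq (seq T)) :
  all a (flatten ss) = all (all a) ss.
Proof. by elim: ss => //= s ss IH; rewrite all_cat IH. Qed.

Lemma sum_count_mem (J : finType) (M : nmodType) (F : J -> M) (L : seq J) :
  \sum_(j <- L) F j = \sum_j F j *+ count_mem j L.
Proof.
elim: L => [|k L IH]; first by rewrite big_nil big1.
rewrite big_cons IH [RHS](bigD1 k)//= eqxx mulrS [in LHS](bigD1 k)//= addrA.
by congr (_ + _); apply: eq_bigr => j; rewrite eq_sym => /negbTE ->.
Qed.

Section Walks.
Variables (V J : finType) (src tgt : J -> V).
Implicit Types (j : J) (L S : seq J) (u v x y : V).

Fixpoint walk x L y : bool :=
  if L is j :: L' then (src j == x) && walk (tgt j) L' y else x == y.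

Lemma walk_cat x y z L L' : walk x L y -> walk y L' z -> walk x (L ++ L') z.
Proof.
elim: L x => [|j L IH] x /= => [/eqP -> //|/andP[-> xy] yz].
exact: IH.
Qed.

Lemma walk_rcons x L j : walk x L (src j) -> walk x (rcons L j) (tgt j).
Proof.
by move=> xj; rewrite -cats1; apply: walk_cat xj _; rewrite /= !eqxx.
Qed.

Lemma walk_flatten x (Ls : seq (seq J)) :
  all (fun L => walk x L x) Ls -> walk x (flatten Ls) x.
Proof.
elim: Ls => [|L Ls IH] /= => [_|/andP[xx /IH]]; first exact: eqxx.
exact: walk_cat.
Qed.

Lemma walk_step x y L j i : walk x L y -> (i.+1 < size L)%N ->
  tgt (nth j L i) = src (nth j L i.+1).
Proof.
elim: L x i => // k L IH x [|i] /= /andP[_ kL].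
  by case: L kL {IH} => // l L /= /andP[/eqP ->].
exact: IH kL.
Qed.

Definition divergence v L : int :=
  \sum_(j <- L) ((src j == v)%:Z - (tgt j == v)%:Z).

Lemma divergence_cat v L S :
  divergence v (L ++ S) = divergence v L + divergence v S.
Proof. exact: big_cat. Qed.

Lemma divergence_perm v L S : perm_eq L S -> divergence v L = divergence v S.
Proof. exact: perm_big. Qed.

Lemma divergence_flatten v (Ls : seq (seq J)) :
  divergence v (flatten Ls) = \sum_(L <- Ls) divergence v L.
Proof. by rewrite /divergence big_flatten. Qed.

Lemma divergence_walk v x y L : walk x L y ->
  divergence v L = (x == v)%:Z - (y == v)%:Z.
Proof.
elim: L x => [|j L IH] x /=; first by move/eqP->; rewrite /divergence big_nil
  subrr.
case/andP => /eqP <- /IH jy.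
by rewrite /divergence big_cons -/(divergence v L) jy; lia.
Qed.

Lemma sum_divergence L : \sum_v divergence v L = 0.
Proof.
rewrite exchange_big big1// => j _; rewrite sumrB.
have H (z : V) : \sum_(i : V) (z == i)%:Z = 1.
  by rewrite (bigD1 z)//= eqxx big1 ?addr0// => i; rewrite eq_sym => /negbTE ->.
by rewrite !H subrr.
Qed.

(** Greedy extraction: as long as [x] differs from [y], the divergence at [x] is 1, so some arc of
    [S] leaves [x]; once it is removed, the remaining arcs satisfy the hypothesis from its
    target. *)
Lemma walk_of_divergence S x y :
    (forall v, divergence v S = (x == v)%:Z - (y == v)%:Z) ->
  exists L S', walk x L y /\ perm_eq S (L ++ S').
Proof.
have [n] := ubnP (size S); elim: n S x => // n IH S x Sn Sxy.
have [->|xy] := eqVneq x y; first by exists [::], S; rewrite /= eqxx.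
have /hasP[j jS /eqP jx] : has (fun j => src j == x) S.
  apply: contraPT (Sxy x) => /hasPn Sx.
  rewrite eqxx eq_sym (negbTE xy) subr0.
  suff : divergence x S <= 0 by move=> + E; rewrite E.
  rewrite -oppr_ge0 -sumrN big_seq; apply: sumr_ge0 => j jS.
  by rewrite (negbTE (Sx j jS)); lia.
have Sj := perm_to_rem jS.
have [|v|L [S' [Ly SL]]] := IH (rem j S) (tgt j).
- by have := perm_size Sj => /=; lia.
- have := Sxy v; rewrite (divergence_perm v Sj) /divergence big_cons jx.
  by rewrite -/(divergence v _); lia.
exists (j :: L), S'; split; first by rewrite /= jx eqxx.
by apply: (perm_trans Sj); rewrite /= perm_cons.
Qed.

(** An arc is closed into a cycle by a walk from its target back to its source, which exists because
    the other arcs have the divergence of such a walk; what remains is balanced again. Cycles with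
    the same base are concatenated, so there is one closed walk per vertex whatever the size of
    [S]. *)
Lemma balanced_split S : (forall v, divergence v S = 0) ->
  exists c : V -> seq J, (forall v, walk v (c v) v) /\
    perm_eq S (flatten [seq c v | v <- enum V]).
Proof.
have [n] := ubnP (size S); elim: n S => // n IH [_ S0|j S /= Sn S0].
  exists (fun=> [::]); split=> [v|]; first exact: eqxx.
  by have -> : flatten [seq [::] | _ <- enum V] = [::] :> seq J
    by elim: (enum V).
have [v|L [S' [jL SL]]] := @walk_of_divergence S (tgt j) (src j).
  by have := S0 v; rewrite /divergence big_cons -/(divergence v S); lia.
have jj : walk (src j) (j :: L) (src j) by rewrite /= eqxx.
have [|v|c [cv Sc]] := IH S'.
  by move: (perm_size SL) Sn; rewrite size_cat /= => ->; lia.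
  have := S0 v; rewrite -cat1s (divergence_perm v (S := j :: L ++ S')).
    2: by rewrite perm_cons.
  by rewrite -cat_cons divergence_cat (divergence_walk _ jj) subrr add0r.
exists (fun v => if v == src j then (j :: L) ++ c v else c v); split=> [v|].
  by case: eqP => [->|_]; [exact: walk_cat jj (cv _)|exact: cv].
have jV : src j \in enum V by rewrite mem_enum.
rewrite (perm_trans (_ : perm_eq _ ((j :: L) ++ S')))//.
  by rewrite /= perm_cons.
have H (f : V -> seq J) : perm_eq (flatten [seq f v | v <- enum V])
    (f (src j) ++ flatten [seq f v | v <- rem (src j) (enum V)]).
  by have /(perm_map f)/perm_flatten := perm_to_rem jV.
rewrite (perm_trans _
  (_ : perm_eq ((j :: L) ++ flatten [seq c v | v <- enum V]) _))//.
  by rewrite perm_cat2l.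
rewrite perm_sym (perm_trans (H _))// perm_sym.
rewrite eqxx -catA perm_cat2l (perm_trans (H _))// perm_cat2l.
have -> // : [seq (if v == src j then (j :: L) ++ c v else c v)
               | v <- rem (src j) (enum V)]
  = [seq c v | v <- rem (src j) (enum V)].
apply/eq_in_map => v; rewrite mem_rem_uniq ?enum_uniq// inE => /andP[vj _].
by rewrite (negbTE vj).
Qed.

Section Completion.
Variable link : V -> V -> seq J.
Hypothesis linkP : forall x y, walk x (link x y) y.

(** From [x] one visits every vertex [v], runs through its closed walk and returns. The added links
    do not depend on [S], which keeps their number bounded. *)
Lemma closed_walk_of_balanced x S : (forall v, divergence v S = 0) ->
  exists W, walk x W x /\
    perm_eq W (S ++ flatten [seq link x v ++ link v x | v <- enum V]).
Proof.
move=> /balanced_split[c [cv Sc]].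
exists (flatten [seq link x v ++ c v ++ link v x | v <- enum V]); split.
  apply: walk_flatten; apply/allP => L /mapP[v _ ->].
  by apply: walk_cat (linkP _ _) _; apply: walk_cat (cv _) (linkP _ _).
apply/permP => a; rewrite count_cat (permP Sc) !count_flatten -!map_comp.
rewrite !sumnE !big_map -big_split; apply: eq_bigr => v _ /=.
by rewrite !count_cat; lia.
Qed.

(* The surplus at each vertex is carried to [x] along links. *)
Definition rebalance x S : seq J :=
  flatten [seq flatten (if divergence v S is Posz k then nseq k (link x v)
                        else nseq `|divergence v S| (link v x)) | v <- enum V].

(** Each [v] contributes [divergence v S] times the difference of the indicators of [x] and [v]. The
    indicators of [x] cancel in total, because the divergences of [S] sum to zero. *)
Lemma divergence_rebalance x S u : divergence u (S ++ rebalance x S) = 0.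
Proof.
rewrite divergence_cat divergence_flatten big_map big_enum /=.
under eq_bigr => v _.
  rewrite (_ : divergence u _ = divergence v S * ((x == u)%:Z - (v == u)%:Z)).
    over.
  case: (divergence v S) => k; rewrite divergence_flatten big_nseq iter_addr_0.
    by rewrite (divergence_walk u (linkP x v)); lia.
  by rewrite (divergence_walk u (linkP v x)); lia.
under eq_bigr do rewrite mulrBr.
rewrite sumrB -mulr_suml sum_divergence mul0r (bigD1 u)//= eqxx mulr1.
by rewrite big1 ?addr0 ?subrr ?add0r ?subrr// => v /negbTE ->; rewrite mulr0.
Qed.

End Completion.

Lemma sumn_count_mem L : (\sum_j count_mem j L)%N = size L.
Proof.
elim: L => [|k L IH] /=; first by rewrite big1.
rewrite big_split /= IH (bigD1 k)//= eqxx big1//= => j.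
by rewrite eq_sym => /negbTE ->.
Qed.

Definition multilist (n : J -> nat) : seq J :=
  flatten [seq nseq (n j) j | j <- enum J].

Lemma count_multilist n j : count_mem j (multilist n) = n j.
Proof.
rewrite count_flatten -map_comp sumnE big_map big_enum /= (bigD1 j)//=.
rewrite count_nseq.
rewrite /= eqxx mul1n big1 ?addn0// => k kj.
by rewrite count_nseq /= (negbTE kj).
Qed.

Lemma big_multilist n (F : J -> int) :
  \sum_(j <- multilist n) F j = \sum_j (n j)%:Z * F j.
Proof.
rewrite big_flatten big_map big_enum /=; apply: eq_bigr => j _.
by rewrite big_nseq iter_addr_0; lia.
Qed.

(** The links that restore balance and connect the support use arcs of [extra] only, so all other
    counts stay exact. The number of links is at most the total imbalance plus twice the number of
    vertices. *)
Lemma closed_walk_of_counts (extra : pred J) (x : V) :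
    (forall x y, exists L, walk x L y && all extra L) ->
  exists C : nat, forall n : J -> nat, exists W,
    [/\ walk x W x, forall j, (n j <= count_mem j W)%N,
      forall j, ~~ extra j -> count_mem j W = n j &
      (size W <= \sum_j n j + C * (1 + \sum_v
         `|(\sum_j (n j)%:Z * ((src j == v)%:Z - (tgt j == v)%:Z))%R|))%N].
Proof.
move=> conn; pose link x y := xchoose (conn x y).
have linkP u v : walk u (link u v) v by have /andP[] := xchooseP (conn u v).
have link_extra u v : all extra (link u v).
  by have /andP[] := xchooseP (conn u v).
pose B := (\max_u \max_v size (link u v))%N.
have linkB u v : (size (link u v) <= B)%N.
  apply: leq_trans (leq_bigmax (F := fun u => \max_v size (link u v))%N u).
  exact: (leq_bigmax (F := fun v => size (link u v)) v).
(* Rebalancing costs at most [B] arcs per unit of imbalance, and the round trips from [x] at most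
   [2 * B] arcs per vertex; the product covers both. *)
exists (2 * B * (1 + #|V|))%N => n; pose S := multilist n.
have [W [xx WS]] := closed_walk_of_balanced linkP x
  (divergence_rebalance linkP x S).
exists W; rewrite -catA in WS.
set X := rebalance link x S ++ _ in WS.
have WE j : count_mem j W = (n j + count_mem j X)%N.
  by rewrite (permP WS) count_cat count_multilist.
have Xe : all extra X.
  rewrite all_cat !all_flatten !all_map; apply/andP; split; apply/allP => v _ /=.
    by rewrite all_flatten; case: (divergence v S) => k; apply/allP => L;
      rewrite mem_nseq => /andP[_ /eqP->].
  by rewrite all_cat !link_extra.
split => // [j|j /negP je|]; first by rewrite WE leq_addr.
  rewrite WE; apply/eqP; rewrite -[X in _ == X]addn0 eqn_add2l -leqn0 leqNgt.
  rewrite -has_count; apply/hasPn => k kX /=; apply/eqP => kj; apply: je.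
  by rewrite -kj (allP Xe).
rewrite (perm_size WS) size_cat.
have -> : size S = (\sum_j n j)%N.
  by rewrite -sumn_count_mem; apply: eq_bigr => j _; rewrite count_multilist.
rewrite leq_add2l /X /rebalance size_cat !size_flatten /shape.
rewrite -!map_comp !sumnE !big_map.
rewrite -!enumT !big_enum /=.
have E v : (\sum_j (n j)%:Z * ((src j == v)%:Z - (tgt j == v)%:Z))%R =
    divergence v S.
  by rewrite /divergence big_multilist.
under [X in (_ <= _ * (1 + X))%N]eq_bigr do rewrite E.
set D := (\sum_v `|divergence v S|)%N.
apply: (@leq_trans (\sum_v B * `|divergence v S| + \sum_(v : V) 2 * B)%N).
  apply: leq_add; apply: leq_sum => v _; last first.
    by rewrite size_cat mul2n -addnn leq_add.
  by case: (divergence v S) => k; rewrite size_flatten /shape map_nseq sumn_nseq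
    leq_mul//.
rewrite -big_distrr /= -/D sum_nat_const (eq_card (B := V))//; nia.
Qed.

End Walks.

Lemma sum_walk_differential (V J : finType) (src tgt : J -> V) (M : zmodType)
    (f : V -> M) x L y : walk src tgt x L y ->
  \sum_(j <- L) (f (tgt j) - f (src j)) = f y - f x.
Proof.
elim: L x => [|j L IH] x /= => [/eqP ->|/andP[/eqP <- /IH jy]].
  by rewrite big_nil subrr.
by rewrite big_cons jy addrC subrKA.
Qed.

(** * Measurability on the tangent bundle *)

Section TangentMeasurability.
Variables (G : graph) (R : realType).
Local Notation T := (tangent G R).

(** At speed zero this depends on the representative chosen for the class, so it selects one of the
    two opposite edges; unlike the rays, its fibres partition the tangent bundle. *)
Definition tedge (x : T) : edge G := (repr x).1.

Lemma tangentE (x : T) : x = tpoint (tedge x) (repr x).2.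
Proof. by rewrite /tpoint -surjective_pairing reprK. Qed.

Lemma tspeed_ge0 (x : T) : 0 <= tspeed x. Proof. by rewrite /tspeed. Qed.

Lemma mdistE (x y : T) : mdist x y =
  if tedge x == tedge y then `|tspeed x - tspeed y|
  else if tedge x == eopp (tedge y) then tspeed x + tspeed y
  else tspeed x + tspeed y + 1.
Proof. by []. Qed.

Lemma mdist_tpointE (x : T) e q : mdist x (tpoint e q) =
  if tedge x == e then `|tspeed x - q%:num|
  else if tedge x == eopp e then tspeed x + q%:num
  else tspeed x + q%:num + 1.
Proof. by rewrite {1}[x]tangentE; exact: tdistE. Qed.

Lemma tedge_tpoint e q : 0 < q%:num -> tedge (tpoint e q : T) = e.
Proof.
move=> q0; rewrite /tedge; case/orP: (tpoint_rel e q) => [/eqP -> //|].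
by case/and3P => _ _ /=; rewrite gt_eqF.
Qed.

Lemma ltr_dist_tspeed (x y : T) : `|tspeed x - tspeed y| <= mdist x y.
Proof.
have := tspeed_ge0 x; have := tspeed_ge0 y; rewrite mdistE ler_norml.
by case: ifP => _; [rewrite -ler_norml|case: ifP => _; lra].
Qed.

Lemma open_mdist (A : set T) :
  (forall x, A x -> exists2 r, 0 < r & forall y, mdist x y < r -> A y) ->
  open A.
Proof.
move=> A_nbhd; rewrite openE => x /A_nbhd[r r0 Ar].
by apply/nbhs_ballP; exists r => //= y; rewrite mdist_ballE => /Ar.
Qed.

Lemma measurable_open (A : set T) : open A -> measurable A.
Proof. by move=> oA; exact: sub_sigma_algebra. Qed.

Lemma measurable_tangent1 (x : T) : measurable [set x].
Proof.
rewrite -[[set x]]setCK; apply: measurableC; apply: measurable_open.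
apply: open_mdist => y yx.
exists (mdist y x) => [|z]; last by move=> + /= zx; rewrite zx ltxx.
rewrite lt_def mdist_ge0 andbT; apply/eqP => /mdist_positivity yx'.
exact: yx.
Qed.

Lemma measurable_tspeed : measurable_fun setT (@tspeed G R).
Proof.
move=> mT; apply: (measurability _ (RGenOInfty.measurableE R)) => //.
move=> _ [_ [a ->] <-]; rewrite setTI; apply: measurable_open.
apply: open_mdist => x /=.
rewrite in_itv/= andbT => ax; exists (tspeed x - a); first by rewrite subr_gt0.
move=> y xy; rewrite /= in_itv/= andbT.
have := le_lt_trans (ltr_dist_tspeed x y) xy.
by have := ler_norm (tspeed x - tspeed y); lra.
Qed.

(** The points of positive speed in the fibre form an open set. The only other candidate is the
    point of speed zero, which belongs to the fibre or not according to its representative. *)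
Lemma measurable_tedge e : measurable (@tedge @^-1` [set e]).
Proof.
have -> : @tedge @^-1` [set e] =
   [set x | tedge x = e /\ 0 < tspeed x] `|`
   (if tedge (tpoint e 0%:nng) == e then [set tpoint e 0%:nng] else set0).
  apply/seteqP; split=> x /=.
    move=> xe; have := tspeed_ge0 x; rewrite le0r => /orP[/eqP x0|].
    2: by left.
    right; have xE : x = tpoint e 0%:nng.
      by rewrite [x]tangentE xe; congr tpoint; exact/val_inj.
    by rewrite -xE xe eqxx.
  by move=> [[] //|]; case: ifP => // /eqP xe ->.
apply: measurableU; last by case: ifP => // _; exact: measurable_tangent1.
apply: measurable_open; apply: open_mdist => x [xe x0].
(* A point over another edge is at distance at least [tspeed x], and over the same edge a closer
   point still has positive speed. *)
exists (tspeed x) => // y.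
have := tspeed_ge0 y; rewrite mdistE xe; case: eqVneq => [ey _|_].
  move=> xy /=; split=> //; have := ler_norm (tspeed x - tspeed y); lra.
by case: ifP => _ /=; lra.
Qed.

Lemma measurable_ray e : measurable (@ray G R e).
Proof.
have -> : @ray G R e = @tedge @^-1` [set e] `|` [set tpoint e 0%:nng].
  apply/seteqP; split=> x /=; last first.
    by move=> [<-|->]; [exists (repr x).2 => //; rewrite -tangentE|exists 0%:nng].
  move=> [q _ <-]; have : 0 <= q%:num by []; rewrite le0r => /orP[/eqP q0|q0].
    by right; congr tpoint; apply/val_inj.
  by left; exact: tedge_tpoint.
by apply: measurableU; [exact: measurable_tedge|exact: measurable_tangent1].
Qed.

(** The sigma-algebra here is the product one, so the metric is treated by its formula: a case
    distinction on finitely many pairs of edges, with measurable functions of the two speeds in each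
    case. *)
Lemma measurable_mdist :
  measurable_fun setT (fun z : T * T => mdist z.1 z.2).
Proof.
have mE (f : edge G -> edge G) :
    measurable_fun setT (fun z : T * T => tedge z.1 == f (tedge z.2)).
  apply: (measurable_fun_bool true); rewrite setTI.
  have -> : (fun z : T * T => tedge z.1 == f (tedge z.2)) @^-1` [set true] =
    \big[setU/set0]_(e <- enum (edge G))
      ((@tedge @^-1` [set f e]) `*` (@tedge @^-1` [set e])).
    rewrite -bigcup_seq; apply/seteqP; split=> z /=.
      by move/eqP => ze; exists (tedge z.2) => //=; rewrite mem_enum.
    by move=> [e _ [/= -> ->]]; exact: eqxx.
  apply: bigsetU_measurable => e _.
  by apply: measurableX; exact: measurable_tedge.
have m1 : measurable_fun setT (fun z : T * T => tspeed z.1).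
  exact: measurableT_comp measurable_tspeed measurable_fst.
have m2 : measurable_fun setT (fun z : T * T => tspeed z.2).
  exact: measurableT_comp measurable_tspeed measurable_snd.
apply: (eq_measurable_fun (fun z : T * T =>
  if tedge z.1 == id (tedge z.2) then `|tspeed z.1 - tspeed z.2|
  else if tedge z.1 == eopp (tedge z.2) then tspeed z.1 + tspeed z.2
  else tspeed z.1 + tspeed z.2 + 1)) => //.
apply: measurable_fun_ifT; first exact: (mE id).
  by apply: measurableT_comp => //; exact: measurable_funB.
apply: measurable_fun_ifT; [exact: (mE (@eopp G))|exact: measurable_funD|].
by apply: measurable_funD => //; exact: measurable_funD.
Qed.

Lemma measurable_mdistl (p : T) : measurable_fun setT (fun x : T => mdist x p).
Proof.
apply: (measurableT_comp measurable_mdist (g := fun x => (x, p))).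
exact: measurable_pair2.
Qed.

End TangentMeasurability.

(** * Finite sums of measures and transport plans *)

Section FiniteSums.
Context d (T : measurableType d) (R : realType).
Local Open Scope ereal_scope.

Lemma ge0_integral_mrestr (mu : {measure set T -> \bar R}) (D : set T)
    (mD : measurable D) (f : T -> \bar R) :
  (forall x, 0 <= f x) -> measurable_fun setT f ->
  \int[mrestr mu mD]_x f x = \int[mu]_(x in D) f x.
Proof.
move=> f0 mf; rewrite [LHS](ge0_negligible_integral (N := ~` D))//=.
rewrite setTD setCK; apply: eq_measure_integral => A mA AD.
  by rewrite /= /mrestr (setIidl AD).
- exact: measurableC.
- by rewrite /= /mrestr setICl measure0.
Qed.

Definition mseq_sum (ms : seq {measure set T -> \bar R}) :=
  msum (nth (mzero : {measure set T -> \bar R}) ms) (size ms).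

Lemma mseq_sumE ms A : mseq_sum ms A = \sum_(m <- ms) m A.
Proof. by rewrite (big_nth (mzero : {measure set T -> \bar R})) big_mkord. Qed.

Lemma ge0_integral_mseq_sum ms (D : set T) (f : T -> \bar R) : measurable D ->
  (forall x, D x -> 0 <= f x) -> measurable_fun D f ->
  \int[mseq_sum ms]_(x in D) f x = \sum_(m <- ms) \int[m]_(x in D) f x.
Proof.
move=> mD f0 mf; rewrite ge0_integral_measure_sum//.
by rewrite (big_nth (mzero : {measure set T -> \bar R})) big_mkord.
Qed.

Variables (mu : {measure set T -> \bar R}) (I : finType) (cl : T -> I).
Hypothesis mcl : forall i, measurable (cl @^-1` [set i]).

Lemma measurable_class (F : I -> R) : measurable_fun setT (F \o cl).
Proof.
move=> _ B _; rewrite setTI.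
have -> : (F \o cl) @^-1` B =
    \big[setU/set0]_(i <- enum I | `[< B (F i) >]) (cl @^-1` [set i]).
  rewrite -bigcup_seq_cond; apply/seteqP; split=> x /=.
    by move=> Bx; exists (cl x) => //=; rewrite mem_enum/=; exact/asboolP.
  by move=> [i /= /andP[_ /asboolP Bi] ->].
by apply: bigsetU_measurable => i _; exact: mcl.
Qed.

Lemma trivIset_class D : trivIset D (fun i => cl @^-1` [set i]).
Proof. by move=> i j _ _ [x [/= <- <-]]. Qed.

Lemma bigcup_class : \bigcup_(i in [set` enum I]) (cl @^-1` [set i]) = setT.
Proof.
by apply/seteqP; split=> // x _; exists (cl x) => //=; rewrite mem_enum.
Qed.

Lemma ge0_integral_class (f : T -> \bar R) : (forall x, 0 <= f x) ->
  measurable_fun setT f ->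
  \int[mu]_x f x = \sum_i \int[mu]_(x in cl @^-1` [set i]) f x.
Proof.
move=> f0 mf; rewrite -bigcup_class bigcup_seq ge0_integral_bigsetU//=.
- by rewrite big_enum.
- exact: enum_uniq.
- exact: trivIset_class.
- exact: measurable_funTS.
Qed.

Lemma measure_class (A : set T) : measurable A ->
  mu A = \sum_i mu (A `&` cl @^-1` [set i]).
Proof.
move=> mA; have := @ge0_integral_class (fun x => (\1_A x)%:E).
rewrite integral_indic// setIT => -> //.
  apply: eq_bigr => i _; rewrite integral_indic//.
  by apply/measurable_EFinP; exact: measurable_indic.
Qed.

Lemma ge0_integral_class_cst (h : I -> R) : (forall i, 0 <= h i)%R ->
  \int[mu]_x (h (cl x))%:E = \sum_i (h i)%:E * mu (cl @^-1` [set i]).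
Proof.
move=> h0; rewrite ge0_integral_class//; last 2 first.
- by move=> x; rewrite lee_fin.
- by apply/measurable_EFinP; exact: measurable_class.
apply: eq_bigr => i _; rewrite -integral_cst//.
by apply: eq_integral => x; rewrite inE /= => ->.
Qed.

End FiniteSums.

Section Transport.
Variables (G : graph) (R : realType).
Local Notation T := (tangent G R).
Local Open Scope ereal_scope.
Variables (mu nu : probability T R) (I J : finType) (cl : T -> I) (p : J -> T).
Hypothesis mcl : forall i, measurable (cl @^-1` [set i]).
Variable w : I -> J -> R.
Hypothesis w0 : forall i j, (0 <= w i j)%R.
Hypothesis w1 : forall i, (\sum_j w i j = 1)%R.
Hypothesis nuE : forall A, measurable A ->
  nu A = \sum_j (\sum_i (w i j)%:E * mu (cl @^-1` [set i])) * \d_(p j) A.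

(** The class [i] sends the share [w i j] of its mass to the point [p j]. The first marginal is [mu]
    by [w1], the second is [nu] by [nuE]. *)
Let piece (k : I * J) : {measure set (T * T) -> \bar R}.
Proof.
refine (mscale (NngNum (w0 k.1 k.2))
  (pushforward (mrestr mu (mcl k.1)) (fun x => (x, p k.2)))).
exact: pair2_measurable.
Defined.

Let plan := mseq_sum [seq piece k | k <- enum {: I * J}].

Let planE A : plan A = \sum_i \sum_j
  (w i j)%:E * mu ((fun x => (x, p j)) @^-1` A `&` cl @^-1` [set i]).
Proof. by rewrite /plan mseq_sumE big_map big_enum pair_bigA. Qed.

Let plan_fst A : measurable A -> plan (A `*` setT) = mu A.
Proof.
move=> mA; rewrite planE (measure_class mu mcl mA); apply: eq_bigr => i _.
rewrite -[RHS]mul1e -(w1 i) -sumEFin ge0_sume_distrl//; last first.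
  by move=> j _; rewrite lee_fin.
apply: eq_bigr => j _; congr (_ * mu (_ `&` _)).
by apply/seteqP; split => x //= [].
Qed.

Let plan_snd A : measurable A -> plan (setT `*` A) = nu A.
Proof.
move=> mA; rewrite planE nuE// exchange_big; apply: eq_bigr => j _ /=.
rewrite ge0_sume_distrl//; last by move=> i _; rewrite mule_ge0// lee_fin.
apply: eq_bigr => i _; rewrite -muleA; congr (_ * _); rewrite diracE.
have [/set_mem pA|/negP pA] := boolP (p j \in A).
  rewrite mule1; congr (mu _).
  by apply/seteqP; split => x //= [].
rewrite mule0 (_ : _ `&` _ = set0) ?measure0//.
by apply/seteqP; split => x //= [[_ /mem_set]].
Qed.

Let plan_setT : plan setT = 1.
Proof. by rewrite -setXTT plan_fst// probability_setT. Qed.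

HB.instance Definition _ := Measure.on plan.
HB.instance Definition _ := Measure_isProbability.Build _ _ _ plan plan_setT.

(** The cost of [plan] bounds the infimum over couplings; both sides are expanded over the pairs of
    a class and a target point. *)
Lemma wasserstein1_le :
  wasserstein1 mu nu <= \int[mu]_x (\sum_j w (cl x) j * mdist x (p j))%:E.
Proof.
apply: ereal_inf_lbound; exists (plan : probability _ R).
  by move=> A mA; split; [exact: plan_fst|exact: plan_snd].
have m1 : measurable_fun setT (fun z : T * T => (mdist z.1 z.2)%:E).
  by apply/measurable_EFinP; exact: measurable_mdist.
have m2 q : measurable_fun setT (fun x : T => (mdist x q)%:E).
  by apply/measurable_EFinP; exact: measurable_mdistl.
have m3 : measurable_fun setT (fun x => (\sum_j w (cl x) j * mdist x (p j))%:E).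
  apply/measurable_EFinP; apply: measurable_sum => j.
  apply: measurable_funM; last exact: measurable_mdistl.
  exact: (measurable_class mcl (fun i => w i j)).
rewrite [LHS]ge0_integral_mseq_sum//; last by move=> z _; rewrite lee_fin mdist_ge0.
rewrite big_map big_enum /= (ge0_integral_class mu mcl)//; last first.
  by move=> x; rewrite lee_fin sumr_ge0// => j _; rewrite mulr_ge0// mdist_ge0.
transitivity (\sum_i \sum_j
  (w i j)%:E * \int[mu]_(x in cl @^-1` [set i]) (mdist x (p j))%:E).
  rewrite pair_bigA; apply: eq_bigr => -[i j] _ /=.
  rewrite ge0_integral_mscale//; last by move=> z _; rewrite lee_fin mdist_ge0.
  rewrite ge0_integral_pushforward//; last first.
    by move=> z _; rewrite lee_fin mdist_ge0.
  rewrite preimage_setT ge0_integral_mrestr//=; last exact: m2.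
  by move=> z; rewrite lee_fin mdist_ge0.
apply: eq_bigr => i _.
under [RHS]eq_integral => x /[!inE]/= ->.
  rewrite -sumEFin; under eq_bigr do rewrite EFinM; over.
rewrite ge0_integral_sum//=.
- apply: eq_bigr => j _; rewrite ge0_integralZl_EFin//.
  + by move=> x _; rewrite lee_fin mdist_ge0.
  + exact: measurable_funTS.
- move=> j; apply: measurable_funTS; apply/measurable_EFinP.
  by apply: measurable_funM => //; exact: measurable_mdistl.
- by move=> j x _; rewrite -EFinM lee_fin mulr_ge0// mdist_ge0.
Qed.

End Transport.

(** * Occupation measures of walks at positive speed *)

Section WalkPath.
Variables (G : graph) (R : realType) (J : finType).
Variables (ed : J -> edge G) (sp : J -> {posnum R}).
Local Notation T := (tangent G R).
Local Notation src := (fun j => origin (ed j)).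
Local Notation tgt := (fun j => terminal (ed j)).
Variables (x y : vertex G) (j0 : J) (L : seq J).
Hypothesis xLy : walk src tgt x (j0 :: L) y.
Local Notation W := (j0 :: L).

Let jW (i : 'I_(size L).+1) : J := nth j0 W i.

Let jW_path : is_path (ed \o jW).
Proof.
move=> i i' ii'; rewrite /= /jW ii'.
by apply: (walk_step (src := src) (tgt := tgt) j0 xLy); rewrite -ii' ltn_ord.
Qed.

Let jW_timeE (i : 'I_(size L).+1) : 0 < (sp (jW i))%:num%:nng%:num ->
  (sp (jW i))%:num^-1%:pos%:num = 1 / (sp (jW i))%:num%:nng%:num.
Proof. by rewrite div1r. Qed.

Let jW_all0 : (forall i, (sp (jW i))%:num%:nng%:num = 0) ->
  origin ((ed \o jW) ord0) = terminal ((ed \o jW) ord_max).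
Proof. by move=> /(_ ord0)/eqP; rewrite gt_eqF//=. Qed.

Let jW_turn (i j : 'I_(size L).+1) : j = i.+1 :> nat ->
  (sp (jW i))%:num%:nng%:num = 0 -> (ed \o jW) j <> eopp ((ed \o jW) i) ->
  (sp (jW j))%:num%:nng%:num <> 0.
Proof. by move=> _ /eqP; rewrite gt_eqF//=. Qed.

(** All speeds are positive, so no index can lie strictly between [j] and [i]: they are consecutive
    and the path condition applies. *)
Let jW_prev (i j : 'I_(size L).+1) : (sp (jW i))%:num%:nng%:num <> 0 ->
  (j < i)%N -> (sp (jW j))%:num%:nng%:num <> 0 ->
  (forall k : 'I_(size L).+1, (j < k < i)%N -> (sp (jW k))%:num%:nng%:num = 0) ->
  origin ((ed \o jW) i) = terminal ((ed \o jW) j).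
Proof.
move=> _ ji _ between; have [ij|] := ltnP j.+1 i; last first.
  by move=> ij; apply/esym/jW_path; lia.
have jL : (j.+1 < (size L).+1)%N by rewrite (leq_trans ij)// ltnW.
have jk : (j < Ordinal jL < i)%N by rewrite /= ltnSn.
by have /eqP := between _ jk; rewrite gt_eqF//=.
Qed.

Let jW_noprev (i : 'I_(size L).+1) : (sp (jW i))%:num%:nng%:num <> 0 ->
  (forall k : 'I_(size L).+1, (k < i)%N -> (sp (jW k))%:num%:nng%:num = 0) ->
  origin ((ed \o jW) i) = origin ((ed \o jW) ord0).
Proof.
move=> _ before; have [->//|i0] := eqVneq i ord0.
have : (@ord0 (size L) < i)%N.
  by rewrite lt0n; apply: contraNneq i0 => i0; apply/eqP/val_inj.
by move/before/eqP; rewrite gt_eqF//=.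
Qed.

Definition walk_param_path : param_path G R :=
  @ParamPath G R (size L) (ed \o jW) (fun i => (sp (jW i))%:num%:nng)
    (fun i => (sp (jW i))%:num^-1%:pos)
    jW_path jW_timeE jW_all0 jW_turn jW_prev jW_noprev.

Let Tot : R := \sum_(j <- W) (sp j)%:num^-1.

Lemma walk_total_time : total_time walk_param_path = Tot.
Proof. by rewrite /Tot (big_nth j0) big_mkord. Qed.

Let Tot_gt0 : 0 < Tot. Proof. by rewrite -walk_total_time total_time_gt0. Qed.

Lemma walk_occupationE A : occupation_measure walk_param_path A =
  (\sum_(j <- W) ((sp j)%:num^-1 / Tot)%:E *
     \d_(tpoint (ed j) (sp j)%:num%:nng%R) A)%E.
Proof.
rewrite /occupation_measure walk_total_time (big_nth j0) big_mkord.
rewrite ge0_sume_distrr; last by move=> i _; rewrite mule_ge0// lee_fin.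
apply: eq_bigr => i _; rewrite muleA -[RHS]EFinM; congr (_ * _)%:E.
by rewrite mulrC.
Qed.

Let piece j : {measure set T -> \bar R} :=
  mscale (NngNum (divr_ge0 (ltW [gt0 of (sp j)%:num^-1]) (ltW Tot_gt0)))
    \d_(tpoint (ed j) (sp j)%:num%:nng%R).

Let occupationE : (occupation_measure walk_param_path : set T -> \bar R) =
  mseq_sum [seq piece j | j <- W].
Proof.
by apply/funext => A; rewrite mseq_sumE big_map walk_occupationE.
Qed.

(** Duration times speed is 1 for each traversal, so every arc contributes [1 / Tot] to the first
    moment whatever its speed. *)
Lemma ge0_integral_walk_occupation (D : set T) : measurable D ->
  (\int[occupation_measure walk_param_path]_(z in D) (tspeed z)%:E =
   (\sum_(j <- W) (tpoint (ed j) (sp j)%:num%:nng%R \in D)%:R / Tot)%:E)%E.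
Proof.
move=> mD; have mf : measurable_fun D (fun z : T => (tspeed z)%:E).
  by apply: measurable_funTS; apply/measurable_EFinP; exact: measurable_tspeed.
have f0 (z : T) : D z -> (0 <= (tspeed z)%:E)%E by rewrite lee_fin tspeed_ge0.
rewrite occupationE ge0_integral_mseq_sum// big_map -sumEFin.
apply: eq_bigr => j _; rewrite ge0_integral_mscale// integral_dirac//.
rewrite diracE tspeedE -!EFinM /=; congr EFin.
by rewrite mulrC -mulrA mulVKf.
Qed.

(** The flux through an edge is its number of traversals over [Tot], so the integral of a
    differential telescopes along the walk. *)
Lemma walk_occupation_closed : x = y ->
  closed_measures (occupation_measure walk_param_path).
Proof.
move=> xy; split=> [|f].
  by rewrite /finite_first_moment ge0_integral_walk_occupation// ltry.
transitivity (\sum_(j <- W) differential f (ed j) / Tot).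
  rewrite (eq_bigr (fun e : edge G =>
    \sum_(j <- W) differential f e * ((ed j == e)%:R / Tot))) => [|e _].
    rewrite exchange_big; apply: eq_bigr => j _; rewrite (bigD1 (ed j))//=.
    rewrite eqxx mul1r big1 ?addr0// => e; rewrite eq_sym => /negbTE ->.
    by rewrite mul0r mulr0.
  rewrite /Rintegral ge0_integral_walk_occupation; last exact: measurable_ray.
  rewrite /= mulr_sumr; apply: eq_bigr => j _; congr (_ * ((nat_of_bool _)%:R / _)).
  (* At positive speed a point lies on one ray only, hence it determines its edge. *)
  apply/idP/eqP => [/set_mem[q _ jq]|<-]; last by rewrite inE; eexists.
  have /(congr1 (@tedge G R)) := jq; rewrite [RHS]tedge_tpoint//= => <-.
  rewrite tedge_tpoint//=; have /(congr1 (@tspeed G R)) := jq.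
  by rewrite !tspeedE => -> /=.
by rewrite -mulr_suml (sum_walk_differential f xLy) xy subrr mul0r.
Qed.

End WalkPath.

(** A path of the graph is lifted arc by arc, by induction on its prefixes. With [lift] the
    injection of the unit-speed arcs, this yields the links between vertices. *)
Lemma connected_walk (G : graph) (J : finType) (ed : J -> edge G)
    (lift : edge G -> J) : cancel lift ed -> connected_graph G ->
  forall x y, exists L,
    walk (fun j => origin (ed j)) (fun j => terminal (ed j)) x L y &&
    all (mem (codom lift)) L.
Proof.
move=> liftK conn x y; have [n [p [pP <- <-]]] := conn x y.
exists (mkseq (fun i => lift (p (inord i))) n.+1); apply/andP; split; last first.
  by apply/allP => j /mapP[i _ ->]; exact: codom_f.
suff H k : (k <= n)%N -> walk (fun j => origin (ed j)) (fun j => terminal (ed j))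
    (origin (p ord0)) (mkseq (fun i => lift (p (inord i))) k.+1)
    (terminal (p (inord k))).
  by have := H n (leqnn n); congr (walk _ _ _ _ (terminal (p _)));
    apply/val_inj; rewrite /= inordK.
elim: k => [_|k IH kn].
  by rewrite /= liftK -[ord0](inord_val) !eqxx.
rewrite mkseqS -[X in terminal X]liftK.
apply: (walk_rcons (tgt := fun j => terminal (ed j))).
rewrite liftK -(pP (inord k) (inord k.+1)); first exact/IH/ltnW.
by rewrite !inordK// ltnS ltnW.
Qed.

(** * Closed walks that follow a circulation up to a bounded error *)

Section Counts.
Variables (R : realType) (G : graph) (I : finType) (eI : I -> edge G).
Variable s : I -> {posnum R}.

(** Arcs of an auxiliary multigraph: traversals of one edge at different speeds are parallel arcs,
    counted separately, and every edge has in addition a unit-speed arc. *)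
Definition arc_edge (j : I + edge G) : edge G :=
  match j with inl i => eI i | inr e => e end.

Definition arc_speed (j : I + edge G) : {posnum R} :=
  match j with inl i => s i | inr _ => 1%:pos end.

Local Notation src := (fun j => origin (arc_edge j)).
Local Notation tgt := (fun j => terminal (arc_edge j)).

(** Reversing edges exchanges origins and terminal vertices. Hence a constant flow is a circulation,
    and [F] may be shifted by a constant on all edges. *)
Lemma sum_differential (f : vertex G -> R) :
  \sum_(e : edge G) differential f e = 0.
Proof.
rewrite sumrB [X in X - _](reindex_inj (inv_inj (@eoppK G))) /= /terminal.
by under eq_bigr do rewrite eoppK; rewrite subrr.
Qed.

Lemma truncn_close (x : R) : 0 <= x ->
  0 <= x - (Num.truncn x)%:R <= 1.
Proof.
move=> x0; have /andP[] := truncn_itv x0.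
by rewrite -natr1; lra.
Qed.

(* The walk is obtained by rounding down [N * m i * s i] and
   [N * (F e + k - \sum_(i | eI i == e) m i * s i)], which breaks the balance at
   each vertex by an amount independent of [N]. *)
Lemma closed_walk_of_flow (m : I -> R) (F : edge G -> R) (k : R) :
    connected_graph G ->
    (forall i, 0 <= m i) -> \sum_i m i = 1 ->
    (forall f : vertex G -> R, \sum_e differential f e * F e = 0) ->
    (forall e, `|F e - \sum_(i | eI i == e) m i * (s i)%:num| <= k) ->
  exists C : R, forall N : nat, exists x j0 L,
    let W := j0 :: L in let Tot := \sum_(j <- W) (arc_speed j)%:num^-1 in
    [/\ walk src tgt x W x,
      forall i, N%:R * m i - (s i)%:num^-1 <=
        (count_mem (inl i) W)%:R / (s i)%:num <= N%:R * m i,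
      N%:R <= Tot, Tot <= N%:R * (1 + 2 * k * #|edge G|%:R) + C &
      (0 < \sum_e count_mem (inr e) W)%N].
Proof.
move=> conn m0 m1 Fclosed Fk.
pose flow e := \sum_(i | eI i == e) m i * (s i)%:num.
(* Flow assigned to the unit-speed arc of [e]. The shift by [k] makes it nonnegative, and it is at
   most [2 * k]. *)
pose D e := F e + k - flow e.
have D0 e : 0 <= D e by move: (Fk e); rewrite ler_norml -/(flow e) /D; lra.
have Dk e : D e <= 2 * k by move: (Fk e); rewrite ler_norml -/(flow e) /D; lra.
(* [P.+1] bounds the time lost by rounding down the counts of the arcs [inl i]. Adding it to each
   [inr] count brings the duration up to at least [N]. *)
have [P PI] : exists P : nat, \sum_i (s i)%:num^-1 <= P.+1%:R.
  by exists (Num.truncn (\sum_i (s i)%:num^-1)); apply/ltW; rewrite truncnS_gt.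
have [e0] : exists e0 : edge G, True.
  by have /card_gt0P[e0 _] := edge_neq0 G; exists e0.
move=> _; pose x0 := origin e0.
have [C0 walkC] := closed_walk_of_counts (src := src) (tgt := tgt) x0
  (@connected_walk G _ arc_edge inr (fun=> erefl) conn).
pose C1 := (#|edge G| * (#|I| + 1 + P.+1))%N.
exists ((#|edge G| * P.+1 + C0 * (1 + #|vertex G| * C1))%N%:R) => N.
pose n (j : I + edge G) := match j with
  | inl i => Num.truncn (N%:R * m i * (s i)%:num)
  | inr e => (Num.truncn (N%:R * D e) + P.+1)%N end.
have n_inl i : 0 <= N%:R * m i * (s i)%:num - (n (inl i))%:R <= 1.
  by apply: truncn_close; rewrite !mulr_ge0.
have n_inr e : 0 <= N%:R * D e + P.+1%:R - (n (inr e))%:R <= 1.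
  have : 0 <= N%:R * D e by rewrite mulr_ge0.
  by move/truncn_close; rewrite /n natrD; lra.
have [W [Wx nW Wn sizeW]] := walkC n.
have W_inl i : count_mem (inl i) W = n (inl i).
  by apply: Wn; apply/negP => /codomP[].
have W_inr e : (P.+1 <= count_mem (inr e) W)%N.
  by apply: leq_trans (nW _); rewrite leq_addl.
(* The flow [N * (F e + k)] is a circulation, so it can be subtracted from the counts. On each edge
   there remain at most [#|I|] rounding errors from the classes, one from [D e], and the added
   [P.+1]. *)
have imbalance v : (`|(\sum_j (n j)%:Z *
    ((src j == v)%:Z - (tgt j == v)%:Z))%R| <= C1)%N.
  pose a (e : edge G) : R := (origin e == v)%:R - (terminal e == v)%:R.
  have aE e : a e = - differential (fun u => (u == v)%:R) e by rewrite opprB.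
  pose cnt e : R := \sum_(i | eI i == e) (n (inl i))%:R + (n (inr e))%:R.
  rewrite -(ler_nat R) natr_absz intr_norm rmorph_sum /=.
  have -> : \sum_j ((n j)%:Z * ((src j == v)%:Z - (tgt j == v)%:Z))%:~R =
      \sum_e a e * (cnt e - N%:R * (F e + k)).
    under [RHS]eq_bigr do rewrite mulrBr.
    rewrite sumrB (_ : \sum_e a e * (N%:R * (F e + k)) = 0) ?subr0; last first.
      transitivity (- N%:R * (\sum_e differential (fun u => (u == v)%:R) e * F e +
        k * \sum_(e : edge G) differential (fun u => (u == v)%:R : R) e)).
        rewrite mulr_sumr -big_split mulr_sumr; apply: eq_bigr => e _ /=.
        by rewrite aE; ring.
      by rewrite Fclosed sum_differential mulr0 addr0 mulr0.
    rewrite big_sumType /=; under [RHS]eq_bigr do rewrite mulrDr.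
    rewrite big_split /=; congr (_ + _); last first.
      by apply: eq_bigr => e _; rewrite intrM intrB mulrC.
    under [RHS]eq_bigr do rewrite mulr_sumr.
    rewrite (exchange_big_dep xpredT)//=; apply: eq_bigr => i _.
    rewrite (big_pred1 (eI i)) => [|e]; last by rewrite eq_sym.
    by rewrite intrM intrB mulrC.
  apply: (le_trans (ler_norm_sum _ _ _)).
  rewrite /C1 natrM mulr_natl -sumr_const; apply: ler_sum => e _.
  rewrite normrM (@le_trans _ _ `|cnt e - N%:R * (F e + k)|)//.
    by rewrite ler_piMl// /a; case: eqP; case: eqP => _ _;
      rewrite ?subrr ?subr0 ?sub0r ?normrN ?normr0 ?normr1.
  have -> : cnt e - N%:R * (F e + k) =
      - (\sum_(i | eI i == e) (N%:R * m i * (s i)%:num - (n (inl i))%:R)) +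
      ((n (inr e))%:R - N%:R * D e).
    rewrite sumrB /cnt /D /flow.
    have -> : \sum_(i | eI i == e) N%:R * m i * (s i)%:num =
      N%:R * \sum_(i | eI i == e) m i * (s i)%:num.
      by rewrite mulr_sumr; apply: eq_bigr => i _; rewrite mulrA.
    by ring.
  have S0 : 0 <= \sum_(i | eI i == e) (N%:R * m i * (s i)%:num - (n (inl i))%:R).
    by apply: sumr_ge0 => i _; have /andP[] := n_inl i.
  have S1 : \sum_(i | eI i == e) (N%:R * m i * (s i)%:num - (n (inl i))%:R) <= #|I|%:R.
    rewrite (@le_trans _ _ (\sum_(i | eI i == e) 1))//.
      by apply: ler_sum => i _; have /andP[] := n_inl i.
    by rewrite sumr_const ler_nat max_card.
  have P0 : 0 <= P.+1%:R :> R by [].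
  have := n_inr e; rewrite !natrD ler_norml; lra.
have sumW (g : I + edge G -> R) : \sum_(j <- W) g j =
    \sum_i g (inl i) *+ count_mem (inl i) W + \sum_e g (inr e) *+ count_mem (inr e) W.
  by rewrite sum_count_mem big_sumType.
have WE : W = head (inr e0) W :: behead W.
  by case: (W) (W_inr e0).
have Wi i : N%:R * m i - (s i)%:num^-1 <=
    (count_mem (inl i) W)%:R / (s i)%:num <= N%:R * m i.
  have := n_inl i; rewrite W_inl ler_pdivrMr// ler_pdivlMr// mulrBl mulVf//.
  by lra.
have P_le : (P.+1 <= \sum_e count_mem (inr e) W)%N.
  by rewrite (bigD1 e0)//= (leq_trans (W_inr e0))// leq_addr.
have TotE : \sum_(j <- W) (arc_speed j)%:num^-1 =
    \sum_i (count_mem (inl i) W)%:R / (s i)%:num +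
    (\sum_e count_mem (inr e) W)%:R.
  rewrite sumW natr_sum; congr (_ + _); apply: eq_bigr => z _ /=.
    by rewrite mulr_natl.
  by rewrite invr1.
have sumWi : N%:R - P.+1%:R <= \sum_i (count_mem (inl i) W)%:R / (s i)%:num <= N%:R.
  have NE : N%:R = \sum_i N%:R * m i by rewrite -mulr_sumr m1 mulr1.
  apply/andP; split.
    rewrite (@le_trans _ _ (\sum_i (N%:R * m i - (s i)%:num^-1)))//.
      by rewrite sumrB -NE lerB.
    by apply: ler_sum => i _; have /andP[] := Wi i.
  by rewrite [leRHS]NE; apply: ler_sum => i _; have /andP[] := Wi i.
exists x0, (head (inr e0) W), (behead W); rewrite -WE /=; split=> //.
- rewrite TotE; move: P_le; rewrite -(ler_nat R).
  by move: sumWi => /andP[+ _]; lra.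
(* The [inl] counts are exact, so all arcs in excess of the prescribed numbers are of unit speed and
   the size bound controls their duration. *)
- have sizeWE : (size W = \sum_i n (inl i) + \sum_e count_mem (inr e) W)%N.
    rewrite -sumn_count_mem big_sumType /=; congr (_ + _)%N.
    by apply: eq_bigr => i _; exact: W_inl.
  have : (\sum_e count_mem (inr e) W <=
      \sum_e n (inr e) + C0 * (1 + #|vertex G| * C1))%N.
    rewrite -(leq_add2l (\sum_i n (inl i))) -sizeWE (leq_trans sizeW)//.
    rewrite big_sumType /= -addnA leq_add2l leq_add2l leq_mul2l leq_add2l.
    rewrite -sum_nat_const (leq_trans (leq_sum _ (fun v _ => imbalance v))) ?orbT//.
  rewrite -(ler_nat R) natrD [in X in _ <= X + _]natr_sum TotE => sum_le.
  have sum_n : \sum_(e : edge G) (n (inr e))%:R <=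
      #|edge G|%:R * (N%:R * (2 * k) + P.+1%:R) :> R.
    rewrite mulr_natl -sumr_const; apply: ler_sum => e _.
    have := n_inr e; have := ler_wpM2l (ler0n R N) (Dk e); lra.
  by move: sumWi => /andP[_]; rewrite natrD natrM; nra.
- exact: leq_trans P_le.
Qed.
End Counts.

(** * Approximation of closed measures *)

Section Quantization.
Import HBSimple.

(** The classes are the fibres of a simple function [g] close to [f] in the L1 norm. *)
Lemma ge0_quantization d (T : measurableType d) (R : realType)
    (mu : probability T R) (f : T -> R) (eps : R) :
    0 < eps -> (forall x, 0 <= f x) -> mu.-integrable setT (EFin \o f) ->
  exists (K : finType) (cl : T -> K) (s : K -> {posnum R}),
    (forall k, measurable (cl @^-1` [set k])) /\
    (\int[mu]_x `|f x - (s (cl x))%:num|%:E <= eps%:E)%E.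
Proof.
move=> eps0 f0 fi; have [g_ [gi _ g_cvg]] := approximation_sfun_integrable measurableT fi.
have eps2 : 0 < eps / 2 by lra.
have [g [gint gf]] : exists g : {sfun T >-> R}, mu.-integrable setT (EFin \o g) /\
    (\int[mu]_x `|f x - g x|%:E <= (eps / 2)%:E)%E.
  have /fine_cvgP[g_fin /cvgrPdist_lt/(_ _ eps2) g_lt] := g_cvg.
  have [n [n_fin]] := filter_ex (filterI g_fin g_lt).
  rewrite sub0r normrN => n_lt; exists (g_ n); split; first exact: gi.
  rewrite -(fineK n_fin) lee_fin; exact: ltW (le_lt_trans (ler_norm _) n_lt).
pose K := fset_set (range g).
have clP x : g x \in K by rewrite in_fset_set ?inE; [exists x|exact: fimfunP].
pose cl x : K := FSetSub (clP x).
(* The absolute value does not increase the distance to [f], which is nonnegative; the shift by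
   [eps / 2] makes the value positive. *)
have s0 (k : K) : 0 < `|val k| + eps / 2 by rewrite ltr_wpDl.
exists K, cl, (fun k => PosNum (s0 k)); split=> [k|].
  rewrite (_ : cl @^-1` [set k] = g @^-1` [set val k]).
    exact: measurable_funPTI.
  by apply/seteqP; split=> x /= => [<-//|xk]; exact/val_inj.
have mf : measurable_fun setT f by apply/measurable_EFinP; case/integrableP: fi.
have mg : measurable_fun setT g by [].
have mfg : measurable_fun setT (fun x => `|f x - g x|%:E).
  by apply/measurable_EFinP; apply: measurableT_comp => //; exact: measurable_funB.
have -> : eps%:E = ((eps / 2)%:E + (eps / 2)%:E)%E by rewrite -EFinD -splitr.
apply: (@le_trans _ _ (\int[mu]_x (`|f x - g x|%:E + (eps / 2)%:E))%E).
  apply: ge0_le_integral => //=.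
  - apply/measurable_EFinP; apply: measurableT_comp => //.
    apply: measurable_funB => //; apply: measurable_funD => //.
    exact: measurableT_comp.
  - exact: emeasurable_funD.
  - move=> x _; rewrite -EFinD lee_fin.
    have := ler_norm (f x - g x); have := ler_norm (- (f x - g x)).
    case: (ger0P (g x)); have := f0 x; rewrite normrN => ? ? ? ?;
      rewrite ler_norml; apply/andP; split; lra.
rewrite ge0_integralD//=; last by move=> x _; rewrite lee_fin ltW.
by rewrite integral_cst// [X in (_ * X)%E]probability_setT mule1 leeD2r.
Qed.
End Quantization.

(** * Transport from a measure to the occupation measure of a closed walk *)

Section WalkTransport.
Variables (G : graph) (R : realType).
Local Notation T := (tangent G R).
Variables (mu : probability T R) (I : finType) (eI : I -> edge G).
Variables (s : I -> {posnum R}) (cl : T -> I).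
Hypothesis mcl : forall i, measurable (cl @^-1` [set i]).
Hypothesis cl_edge : forall x, tedge x = eI (cl x).
Local Notation src := (fun j => origin (arc_edge eI j)).
Local Notation tgt := (fun j => terminal (arc_edge eI j)).
Variables (v : vertex G) (j0 : I + edge G) (L : seq (I + edge G)).
Hypothesis vLv : walk src tgt v (j0 :: L) v.
Local Notation W := (j0 :: L).
Let Tot : R := \sum_(j <- W) (arc_speed s j)%:num^-1.
Let m i : R := fine (mu (cl @^-1` [set i])).
(** Fraction of the total duration spent on the arcs [inl i]. *)
Let b i : R := (count_mem (inl i) W)%:R / (s i)%:num / Tot.
Hypothesis b_le : forall i, b i <= m i.
Hypothesis extra_gt0 : (0 < \sum_e count_mem (inr e) W)%N.

Let Tot_gt0 : 0 < Tot.
Proof.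
by have := total_time_gt0 (walk_param_path (arc_speed s) vLv); rewrite walk_total_time.
Qed.

(** A unit-speed arc lasts 1, so this count is also a duration. *)
Let B : R := (\sum_e count_mem (inr e) W)%:R.
Let B_gt0 : 0 < B. Proof. by rewrite ltr0n. Qed.

Let mE i : mu (cl @^-1` [set i]) = (m i)%:E.
Proof. by rewrite fineK// fin_num_measure. Qed.

Let b0 i : 0 <= b i. Proof. by rewrite !divr_ge0// ltW. Qed.

Let theta i := b i / m i.

Let theta_m i : theta i * m i = b i.
Proof.
(* If [m i] vanishes, so does [b i] by [b_le], and the default value of the division does no
   harm. *)
rewrite /theta; have [mi0|mi0] := eqVneq (m i) 0; last by rewrite divfK.
by apply/eqP; rewrite mi0 mulr0 eq_le b0 -mi0 b_le.
Qed.

Let theta0 i : 0 <= theta i.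
Proof. by rewrite divr_ge0// (le_trans (b0 i)). Qed.

Let theta1 i : theta i <= 1.
Proof.
rewrite /theta; have [->|mi0] := eqVneq (m i) 0; first by rewrite invr0 mulr0.
by rewrite ler_pdivrMr ?mul1r// lt_def mi0 (le_trans (b0 i)).
Qed.

(* The class [i] keeps the fraction [theta i] of its mass next to itself and
   distributes the rest over the unit-speed arcs. *)
Let w i (j : I + edge G) : R := match j with
  | inl i' => (i == i')%:R * theta i
  | inr e => (1 - theta i) * ((count_mem (inr e) W)%:R / B) end.

Let w0 i j : 0 <= w i j.
Proof.
case: j => [i'|e] /=; first by rewrite mulr_ge0.
by rewrite mulr_ge0// ?subr_ge0// divr_ge0// ltW.
Qed.

Let sum_w i (g : I + edge G -> R) : \sum_j w i j * g j =
  theta i * g (inl i) +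
  (1 - theta i) * \sum_e (count_mem (inr e) W)%:R / B * g (inr e).
Proof.
rewrite big_sumType /=; congr (_ + _).
  rewrite (bigD1 i)//= eqxx mul1r big1 ?addr0// => i'.
  by rewrite eq_sym => /negbTE ->; rewrite !mul0r.
by rewrite mulr_sumr; apply: eq_bigr => e _; ring.
Qed.

Let extra1 : \sum_e (count_mem (inr e) W)%:R / B = 1.
Proof. by rewrite -mulr_suml -natr_sum divff// gt_eqF. Qed.

Let w1 i : \sum_j w i j = 1.
Proof.
transitivity (\sum_j w i j * 1); first by apply: eq_bigr => j _; rewrite mulr1.
by rewrite sum_w; under eq_bigr do rewrite mulr1; rewrite extra1; ring.
Qed.

Let sum_b : \sum_i b i = 1 - B / Tot.
Proof.
have TotE : Tot = \sum_i (count_mem (inl i) W)%:R / (s i)%:num + B.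
  rewrite /Tot sum_count_mem big_sumType /B natr_sum; congr (_ + _).
    by apply: eq_bigr => i _; rewrite mulr_natl.
  by apply: eq_bigr => e _; rewrite /arc_speed invr1.
by rewrite -mulr_suml -[X in X / _](addrK B) -TotE mulrBl divff// gt_eqF.
Qed.

Let sum_m : \sum_i m i = 1.
Proof.
apply: EFin_inj; rewrite -sumEFin -(@probability_setT _ _ _ mu).
rewrite (measure_class mu mcl measurableT); apply: eq_bigr => i _.
by rewrite setTI; exact/esym/mE.
Qed.

Let p (j : I + edge G) : T := tpoint (arc_edge eI j) (arc_speed s j)%:num%:nng.

Let occupation_w A : measurable A ->
  occupation_measure (walk_param_path (arc_speed s) vLv) A =
  (\sum_j (\sum_i (w i j)%:E * mu (cl @^-1` [set i])) * \d_(p j) A)%E.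
Proof.
move=> mA; rewrite walk_occupationE.
transitivity (\sum_(j <- W) ((arc_speed s j)%:num^-1 / Tot * (p j \in A)%:R))%:E.
  by rewrite -sumEFin; apply: eq_bigr => j _; rewrite diracE.
transitivity (\sum_j (\sum_i w i j * m i) * (p j \in A)%:R)%:E; last first.
  rewrite -sumEFin; apply: eq_bigr => j _; rewrite EFinM diracE; congr (_ * _)%E.
  by rewrite -sumEFin; apply: eq_bigr => i _; rewrite mE.
congr EFin; rewrite sum_count_mem; apply: eq_bigr => j _.
rewrite -mulrnAl -mulr_natr; congr (_ * _); case: j => [i|e] /=.
  rewrite (bigD1 i)//= eqxx mul1r big1 ?addr0 => [|i' /negbTE ->].
    by rewrite theta_m mulrC mulrA.
  by rewrite !mul0r.
(* The mass not kept by the classes totals [B / Tot]; the arc [inr e] receives it in proportion to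
   its count, which is the fraction of time spent there. *)
under eq_bigr do rewrite mulrAC mulrBl mul1r theta_m.
rewrite -mulr_suml sumrB sum_m sum_b invr1.
have := gt_eqF B_gt0; have := gt_eqF Tot_gt0 => ? ?; field.
by apply/andP; split; apply/negbT.
Qed.

(** The share kept in the class moves along a single ray by the difference of speeds. The rest goes
    to a unit-speed point, at distance at most [tspeed x + 2]. *)
Let integrand_le x : \sum_j w (cl x) j * mdist x (p j) <=
  2 * `|tspeed x - (s (cl x))%:num| + (1 - theta (cl x)) * ((s (cl x))%:num + 2).
Proof.
rewrite sum_w; set i := cl x.
have -> : mdist x (p (inl i)) = `|tspeed x - (s i)%:num|.
  by rewrite mdist_tpointE /= cl_edge eqxx.
have far e : mdist x (p (inr e)) <= `|tspeed x - (s i)%:num| + ((s i)%:num + 2).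
  have := tspeed_ge0 x; have := ler_norm (tspeed x - (s i)%:num).
  have : `|tspeed x - 1| <= tspeed x + 1.
    by rewrite ler_norml; have := tspeed_ge0 x; move=> ?; apply/andP; split; lra.
  have s0 : 0 < (s i)%:num by [].
  rewrite mdist_tpointE /=; case: ifP => _; last case: ifP => _; lra.
have : \sum_e (count_mem (inr e) W)%:R / B * mdist x (p (inr e)) <=
    `|tspeed x - (s i)%:num| + ((s i)%:num + 2).
  move: (_ + (_ + _)) far => K far; have <- : \sum_e (count_mem (inr e) W)%:R / B * K = K.
    by rewrite -mulr_suml extra1 mul1r.
  apply: ler_sum => e _.
  by apply: ler_wpM2l => //; rewrite divr_ge0// ltW.
have := theta0 i; have := theta1 i; have := normr_ge0 (tspeed x - (s i)%:num).
set n := `|_|; set S := \sum_e _ => n0 t1 t0 Sle.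
have : (1 - theta i) * S <= (1 - theta i) * (n + ((s i)%:num + 2)).
  by apply: ler_wpM2l => //; rewrite subr_ge0.
nra.
Qed.

(** [integrand_le] is integrated; its last term is constant on each class, and [(1 - theta i) * m i]
    is [m i - b i]. *)
Lemma wasserstein1_walk :
  (wasserstein1 mu (occupation_measure (walk_param_path (arc_speed s) vLv)) <=
   2%:E * \int[mu]_x `|tspeed x - (s (cl x))%:num|%:E +
   (\sum_i (m i - b i) * ((s i)%:num + 2))%:E)%E.
Proof.
apply: (le_trans (wasserstein1_le mcl w0 w1 occupation_w)).
have ms : measurable_fun setT (fun x => (s (cl x))%:num).
  exact: (measurable_class mcl (fun i => (s i)%:num)).
have mn : measurable_fun setT (fun x => `|tspeed x - (s (cl x))%:num|%:E).
  apply/measurable_EFinP; apply: measurableT_comp => //.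
  by apply: measurable_funB => //; exact: measurable_tspeed.
have mt : measurable_fun setT
    (fun x => ((1 - theta (cl x)) * ((s (cl x))%:num + 2))%:E).
  apply/measurable_EFinP.
  exact: (measurable_class mcl (fun i => (1 - theta i) * ((s i)%:num + 2))).
have t0 i : 0 <= (1 - theta i) * ((s i)%:num + 2).
  by rewrite mulr_ge0// subr_ge0.
apply: (@le_trans _ _ (\int[mu]_x (2%:E * `|tspeed x - (s (cl x))%:num|%:E +
    ((1 - theta (cl x)) * ((s (cl x))%:num + 2))%:E))%E).
  apply: ge0_le_integral => //.
  - by move=> x _; rewrite lee_fin sumr_ge0// => j _; rewrite mulr_ge0// mdist_ge0.
  - apply/measurable_EFinP; apply: measurable_sum => j.
    apply: measurable_funM; last exact: measurable_mdistl.
    exact: (measurable_class mcl (fun i => w i j)).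
  - by apply: emeasurable_funD => //; exact: measurable_funeM.
  - by move=> x _; rewrite -EFinM -EFinD lee_fin integrand_le.
rewrite ge0_integralD//; last 2 first.
- exact: measurable_funeM.
- by move=> x _; rewrite lee_fin t0.
rewrite ge0_integralZl_EFin// (ge0_integral_class_cst mu mcl t0) leeD2l//.
rewrite -sumEFin le_eqVlt (_ : (_ == _) = true)//; apply/eqP.
apply: eq_bigr => i _; rewrite [X in (_ * X)%E]mE -EFinM; congr EFin.
by rewrite -theta_m; ring.
Qed.

End WalkTransport.

Lemma ge0_integral_le_dist d (T : measurableType d) (R : realType)
    (mu : {measure set T -> \bar R}) (A : set T) (f g : T -> R) :
    measurable A -> (forall x, 0 <= f x) -> (forall x, 0 <= g x) ->
    measurable_fun setT f -> measurable_fun setT g ->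
  (\int[mu]_(x in A) (f x)%:E <=
   \int[mu]_(x in A) (g x)%:E + \int[mu]_x `|f x - g x|%:E)%E.
Proof.
move=> mA f0 g0 mf mg.
have mfg : measurable_fun setT (fun x => `|f x - g x|%:E).
  by apply/measurable_EFinP; apply: measurableT_comp => //; exact: measurable_funB.
have mEf : measurable_fun A (EFin \o f) by apply: measurable_funTS; apply/measurable_EFinP.
have mEg : measurable_fun A (EFin \o g) by apply: measurable_funTS; apply/measurable_EFinP.
have mfgA := measurable_funTS (D := A) mfg.
apply: (@le_trans _ _ (\int[mu]_(x in A) ((g x)%:E + `|f x - g x|%:E))%E).
  apply: ge0_le_integral => //=.
  - by move=> x _; rewrite lee_fin.
  - exact: emeasurable_funD.
  - by move=> x _; rewrite -EFinD lee_fin -lerBlDl ler_norm.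
rewrite ge0_integralD//; last by move=> x _; rewrite lee_fin.
rewrite leeD2l//; apply: ge0_subset_integral => //.
Qed.

(** The ray and the fibre of [tedge] differ at most by a point of speed zero, where the integrand
    vanishes. *)
Lemma integral_ray (G : graph) (R : realType) (mu : probability (tangent G R) R) e :
  (\int[mu]_(x in ray e) (tspeed x)%:E =
   \int[mu]_(x in @tedge G R @^-1` [set e]) (tspeed x)%:E)%E.
Proof.
rewrite integral_mkcond [RHS]integral_mkcond; apply: eq_integral => x _.
rewrite /patch; case: ifPn; case: ifPn => //.
- move=> /negP xe /set_mem[q _ qx].
  have [q0|] := ltP 0 q%:num.
    by exfalso; apply: xe; rewrite inE /= -qx tedge_tpoint.
  by move=> q0; congr EFin; apply/eqP; rewrite -qx tspeedE eq_le q0/=.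
- move=> /set_mem xe /negP[]; rewrite inE; exists (repr x).2 => //.
  by rewrite -xe -tangentE.
Qed.

Theorem theorem4p15 (R : realType) (G : graph)
  (G_connected : connected_graph G) (G_loopless : loopless G) :
  wasserstein_dense (@closed_occupation_measures G R) (@closed_measures G R).
Proof.
split=> [mu []//|mu [mu_fin mu_closed] eps eps0].
pose M1 := fine (\int[mu]_x (tspeed x)%:E)%E.
have M1_ge0 : (0 <= \int[mu]_x (tspeed x)%:E)%E.
  by apply: integral_ge0 => x _; rewrite lee_fin tspeed_ge0.
have M1E : (\int[mu]_x (tspeed x)%:E = M1%:E)%E.
  by rewrite fineK// ge0_fin_numE.
have M10 : 0 <= M1 by rewrite fine_ge0.
pose E : R := #|edge G|%:R.
(* Bound for the sum of [m i * (s i + 2)]: the quantized first moment is at most [M1 + d] with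
   [d <= 1], and the masses sum to 1. *)
pose Q := M1 + 3.
have E0 : 0 <= E by [].
have EQ0 : 0 <= E * Q by rewrite mulr_ge0// /Q; lra.
(* The term [2 * d] pays for quantizing the speeds, and [2 * d * E * Q] for the time taken by the
   unit-speed arcs that correct the flux. *)
have [d [d0 d1 d_eps]] : exists d : R,
    [/\ 0 < d, d <= 1 & 2 * d + 2 * d * E * Q <= eps / 2].
  have K0 : 0 < 2 + 2 * (E * Q) by lra.
  exists (Num.min 1 (eps / 2 / (2 + 2 * (E * Q)))); split.
  - by rewrite lt_min ltr01 !divr_gt0.
  - by rewrite ge_min lexx.
  - set d := Num.min _ _; have : d <= eps / 2 / (2 + 2 * (E * Q)).
      by rewrite ge_min lexx orbT.
    by rewrite ler_pdivlMr//; lra.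
have mtspeed := @measurable_tspeed G R.
have tint : mu.-integrable setT (EFin \o @tspeed G R).
  apply/integrableP; split; first exact/measurable_EFinP.
  by under eq_integral => x _ do rewrite /= ger0_norm ?lee_fin ?tspeed_ge0//.
have [K [cl0 [s0 [mcl0 cl0_dist]]]] := ge0_quantization d0 (@tspeed_ge0 G R) tint.
(* A class fixes both the edge and the quantized speed. *)
pose I := (edge G * K)%type.
pose cl (x : tangent G R) : I := (tedge x, cl0 x).
pose s (i : I) := s0 i.2.
have mcl i : measurable (cl @^-1` [set i]).
  have -> : cl @^-1` [set i] = @tedge G R @^-1` [set i.1] `&` cl0 @^-1` [set i.2].
    by apply/seteqP; split=> x /=; [move=> <-|case: i => e k [/= <- <-]].
  by apply: measurableI => //; exact: measurable_tedge.
pose m i : R := fine (mu (cl @^-1` [set i])).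
have mE i : mu (cl @^-1` [set i]) = (m i)%:E by rewrite fineK// fin_num_measure.
have m0 i : 0 <= m i by rewrite fine_ge0.
have int_cl (h : I -> R) : (forall i, 0 <= h i) ->
    (\int[mu]_x (h (cl x))%:E = (\sum_i m i * h i)%:E)%E.
  move=> h0; rewrite (ge0_integral_class_cst mu mcl h0) -sumEFin.
  by apply: eq_bigr => i _; rewrite [X in (_ * X)%E]mE -EFinM mulrC.
have sum_m : \sum_i m i = 1.
  apply: EFin_inj; have := int_cl (fun=> 1) (fun=> ler01).
  rewrite integral_cst// mul1e [LHS]probability_setT => ->.
  by congr EFin; apply: eq_bigr => i _; rewrite mulr1.
have ms : measurable_fun setT (fun x => (s (cl x))%:num).
  exact: (measurable_class mcl (fun i => (s i)%:num)).
have s_ge0 x : 0 <= (s (cl x))%:num by [].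
have dist_sym : (\int[mu]_x `|(s (cl x))%:num - tspeed x|%:E <= d%:E)%E.
  by under eq_integral => x _ do rewrite distrC.
pose F e := (\int[mu]_(x in ray e) tspeed x)%R.
have flowE e : (\int[mu]_(x in @tedge G R @^-1` [set e]) (s (cl x))%:num%:E =
    (\sum_(i | i.1 == e) m i * (s i)%:num)%:E)%E.
  transitivity (\int[mu]_x (if (cl x).1 == e then (s (cl x))%:num else 0)%:E)%E.
    rewrite integral_mkcond; apply: eq_integral => x _.
    rewrite /patch (_ : (x \in _) = (tedge x == e)) /=; first by case: ifP.
    by apply/idP/eqP => [/set_mem//|xe]; rewrite inE.
  rewrite (int_cl (fun i => if i.1 == e then (s i)%:num else 0)) => [|i].
    congr EFin; rewrite [RHS]big_mkcond; apply: eq_bigr => i _.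
    by case: ifP => //; rewrite mulr0.
  by case: ifP.
have F_flow e : `|F e - \sum_(i | i.1 == e) m i * (s i)%:num| <= d.
  have mA := @measurable_tedge G R e.
  have FE : (\int[mu]_(x in @tedge G R @^-1` [set e]) (tspeed x)%:E = (F e)%:E)%E.
    rewrite -integral_ray fineK// ge0_fin_numE; last first.
      by apply: integral_ge0 => x _; rewrite lee_fin tspeed_ge0.
    apply: le_lt_trans mu_fin; apply: ge0_subset_integral => //.
    - exact: measurable_ray.
    - exact/measurable_EFinP.
    - by move=> x _; rewrite lee_fin tspeed_ge0.
  have := ge0_integral_le_dist mu mA s_ge0 (@tspeed_ge0 G R) ms mtspeed.
  have := ge0_integral_le_dist mu mA (@tspeed_ge0 G R) s_ge0 mtspeed ms.
  rewrite flowE FE => /le_trans/(_ (leeD2l _ cl0_dist)) + /le_trans/(_ (leeD2l _ dist_sym)).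
  rewrite -!EFinD !lee_fin ler_norml; lra.
have sum_ms : \sum_i m i * (s i)%:num <= M1 + d.
  have := ge0_integral_le_dist mu measurableT s_ge0 (@tspeed_ge0 G R) ms mtspeed.
  rewrite M1E (int_cl (fun i => (s i)%:num))// => /le_trans/(_ (leeD2l _ dist_sym)).
  by rewrite -EFinD lee_fin.
have [C walkC] := closed_walk_of_flow G_connected m0 sum_m mu_closed F_flow.
(* Cost of rounding: class [i] loses at most the time of one traversal, weighted by [s i + 2]. *)
pose S := \sum_i ((s i)%:num + 2) / (s i)%:num.
have [N [N0 N_large]] : exists N : nat, 0 < N%:R :> R /\ C * Q + S < N%:R * (eps / 2).
  pose x := `|C * Q + S| / (eps / 2).
  exists (Num.truncn x).+1; split; first by rewrite ltr0n.
  rewrite -ltr_pdivrMr ?divr_gt0//; apply: le_lt_trans (truncnS_gt _).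
  by apply: ler_wpM2r (ler_norm _); rewrite invr_ge0 divr_ge0// ltW.
have [v [j0 [L [vLv Wm NTot TotN extra_gt0]]]] := walkC N.
set Tot := \sum_(j <- _) _ in NTot TotN.
have Tot0 : 0 < Tot by exact: lt_le_trans NTot.
pose b i := (count_mem (inl i) (j0 :: L))%:R / (s i)%:num / Tot.
have b_le i : b i <= m i.
  have /andP[_ im] := Wm i; rewrite ler_pdivrMr// (le_trans im)// mulrC.
  by rewrite ler_wpM2l.
exists (occupation_measure (walk_param_path (arc_speed s) vLv)).
  by split; [exact: imageT|exact: walk_occupation_closed].
apply: (le_lt_trans (wasserstein1_walk (eI := fst) mcl (fun=> erefl) vLv b_le extra_gt0)).
apply: (@le_lt_trans _ _ (2%:E * d%:E + (\sum_i (m i - b i) * ((s i)%:num + 2))%:E)%E).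
  by rewrite leeD2r// lee_wpmul2l.
rewrite -EFinM -EFinD lte_fin.
(* The mass missing at class [i] comes from the excess of [Tot] over [N] and from one rounded-off
   traversal. *)
have b_ge i : Tot * (m i - b i) <= (Tot - N%:R) * m i + (s i)%:num^-1.
  have /andP[mi _] := Wm i.
  by rewrite mulrBr /b [Tot * (_ / Tot)]mulrC divfK ?gt_eqF//; lra.
have : Tot * \sum_i (m i - b i) * ((s i)%:num + 2) <= (Tot - N%:R) * Q + S.
  apply: (@le_trans _ _ ((Tot - N%:R) * (\sum_i m i * (s i)%:num + 2 * \sum_i m i) + S)).
    rewrite mulr_sumr [2 * _]mulr_sumr -big_split mulr_sumr -big_split /=.
    apply: ler_sum => i _.
    have s2 : 0 <= (s i)%:num + 2 by [].
    have := ler_wpM2r s2 (b_ge i); lra.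
  rewrite sum_m lerD2r ler_wpM2l ?subr_ge0//; rewrite /Q; lra.
set X := \sum_i _ => TotX.
have Q0 : 0 <= Q by rewrite /Q; lra.
(* The excess [Tot - N] is at most [N * (2 * d * E) + C]; the terms independent of [N] are absorbed
   by [N * (eps / 2)], and [N <= Tot]. *)
suff : Tot * X < Tot * (2 * d * E * Q + eps / 2) by rewrite ltr_pM2l//; lra.
apply: (le_lt_trans TotX).
have : (Tot - N%:R) * Q <= (N%:R * (2 * d * E) + C) * Q.
  by apply: ler_wpM2r => //; rewrite /E; lra.
have Z0 : 0 <= 2 * d * E * Q + eps / 2.
  by have := mulr_ge0 (ltW d0) EQ0; lra.
have := ler_wpM2r Z0 NTot; lra.
Qed.
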